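(* Let $G=(V,E)$ be a graph with $n$ vertices and let $\lambda\in\mathbb{N}$ (so $\lambda\ge 1$). (a) If $\lambda<\chi(G)$ then $\mathrm{FC}_{\lambda}(G;p)$ is identically zero as a polynomial in $p$. (b) If $G$ has at least one edge or $\lambda\ge 2$ then $\mathrm{FC}_{\lambda}(G;0)=0$. (c) $\lambda^{n}\,\mathrm{FC}_{\lambda}(G;\lambda^{-1})=P(G;\lambda)$, where $P(G;\lambda)$ is the number of (proper) $\lambda$-colourings of $G$. (d) $(\lambda+1)^{n}\,\mathrm{FC}_{\lambda}(G;(\lambda+1)^{-1})$ is the number of partial $\lambda$-assignments of $G$ that force a $\lambda$-colouring of $G$. (e) For every graph $H$, if $G\cup H$ denotes the disjoint union of $G$ and $H$, then $\mathrm{FC}_{\lambda}(G\cup H;p)=\mathrm{FC}_{\lambda}(G;p)\,\mathrm{FC}_{\lambda}(H;p)$.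
   Context: All graphs are finite and simple, with nonempty vertex set. $\mathbb{N}=\{1,2,\dots\}$, $[\lambda]=\{1,\dots,\lambda\}$, $\chi(G)$ is the chromatic number, and $N_G(v)$ is the set of neighbours of $v$. A partial $\lambda$-assignment of $G=(V,E)$ is a function $f:W\to[\lambda]$ with $W\subseteq V$; write $\operatorname{dom} f=W$ ($W=\emptyset$ and $W=V$ are allowed). It is total if $\operatorname{dom} f=V$. A $\lambda$-colouring of $G$ is a total $\lambda$-assignment in which adjacent vertices have different colours. A vertex $v\notin\operatorname{dom} f$ is immediately $\lambda$-forced by $f$ if $|\{f(w): w\in N_G(v)\cap\operatorname{dom} f\}|=\lambda-1$; in that case $f;v$ denotes the extension of $f$ to $(\operatorname{dom} f)\cup\{v\}$ that gives $v$ the unique colour of $[\lambda]$ not appearing on its neighbours in $\operatorname{dom} f$. We say $f$ ($\lambda$-)forces a $\lambda$-colouring of $G$ if there is a (possibly empty) sequence of such steps $f=f_0$, $f_i=f_{i-1};v_i$ ($1\le i\le k$, $v_i$ immediately $\lambda$-forced by $f_{i-1}$) with $f_k$ a $\lambda$-colouring of $G$. For $C\subseteq V$, $\mathrm{fcol}(G,C;\lambda)$ is the number of partial $\lambda$-assignments $f$ with $\operatorname{dom} f=C$ that force a $\lambda$-colouring of $G$. The forced $\lambda$-colouring polynomial is the polynomial in $p$ $$\mathrm{FC}_{\lambda}(G;p)=\sum_{C\subseteq V}\mathrm{fcol}(G,C;\lambda)\,p^{|C|}(1-\lambda p)^{n-|C|},\qquad n=|V|.$$ For $0\le p\le\lambda^{-1}$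 this is the probability that a random partial $\lambda$-assignment forces a $\lambda$-colouring of $G$, where independently each vertex receives each particular colour with probability $p$ and remains uncoloured with probability $1-\lambda p$. *)

(* Defs.v *)
From mathcomp Require Import all_boot all_order all_algebra.

Set Implicit Arguments.
Unset Strict Implicit.
Unset Printing Implicit Defensive.

Import GRing.Theory.

Record sgraph := SGraph {
  vertex :> finType;
  adj : rel vertex;
  adj_sym : symmetric adj;
  adj_irr : irreflexive adj;
  vertex_gt0 : 0 < #|vertex|
}.

Definition nbh (G : sgraph) (v : G) : {set G} := [set w | adj v w].

(* A partial assignment with domain W is encoded as a total function to        *)
(* [option 'I_k], equal to [None] exactly outside W; the colours 1, ..., k are *)
(* represented by 0, ..., k - 1.                                               *)
Definition passign (G : sgraph) (k : nat) := {ffun G -> option 'I_k}.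

Definition pdom (G : sgraph) (k : nat) (f : passign G k) : {set G} :=
  [set v | f v != None].

Definition coloring (G : sgraph) (k : nat) (f : passign G k) : bool :=
  (pdom f == [set: G]) && [forall u, forall v, adj u v ==> (f u != f v)].

Definition nbh_colors (G : sgraph) (k : nat) (f : passign G k) (v : G) :
    {set 'I_k} :=
  [set c | [exists w in nbh v :&: pdom f, f w == Some c]].

(* [k.-1] is k - 1 only for positive k. *)
Definition imm_forced (G : sgraph) (k : nat) (f : passign G k) (v : G) : bool :=
  (v \notin pdom f) && (#|nbh_colors f v| == k.-1).

(* When [imm_forced f v] and 0 < k, exactly one colour is missing from         *)
(* [nbh_colors f v], so that [pick] returns [Some] of that colour.             *)
Definition force_ext (G : sgraph) (k : nat) (f : passign G k) (v : G) :
    passign G k :=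
  [ffun w => if w == v then [pick c | c \notin nbh_colors f v] else f w].

Definition force_step (G : sgraph) (k : nat) : rel (passign G k) :=
  [rel f g | [exists v, imm_forced f v && (g == force_ext f v)]].

Definition forces_coloring (G : sgraph) (k : nat) (f : passign G k) : bool :=
  [exists g, connect (@force_step G k) f g && coloring g].

Definition fcol (G : sgraph) (C : {set G}) (k : nat) : nat :=
  #|[set f : passign G k | (pdom f == C) && forces_coloring f]|.

Definition FC (R : nzRingType) (G : sgraph) (k : nat) : {poly R} :=
  (\sum_(C : {set G})
     (fcol C k)%:R * 'X ^+ #|C| * (1 - k%:R * 'X) ^+ (#|G| - #|C|))%R.

Definition num_colorings (G : sgraph) (k : nat) : nat :=
  #|[set f : passign G k | coloring f]|.

Definition num_forcing (G : sgraph) (k : nat) : nat :=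
  #|[set f : passign G k | forces_coloring f]|.

Definition colorable (G : sgraph) (k : nat) : bool :=
  [exists f : passign G k, coloring f].

Lemma colorable_ex (G : sgraph) : exists k, colorable G k.
Proof.
exists #|G|; apply/existsP; exists [ffun v => Some (enum_rank v)].
apply/andP; split; first by apply/eqP/setP=> v; rewrite !inE ffunE.
apply/forallP=> u; apply/forallP=> v; apply/implyP=> uv; rewrite !ffunE.
apply/eqP=> -[/enum_rank_inj uv_eq].
by move: uv; rewrite uv_eq adj_irr.
Qed.

Definition chi (G : sgraph) : nat := ex_minn (colorable_ex G).

Definition union_adj (G H : sgraph) : rel (G + H) := fun x y =>
  match x, y with
  | inl u, inl v => adj u v
  | inr u, inr v => adj u v
  | _, _ => false
  end.

Lemma union_adj_sym (G H : sgraph) : symmetric (@union_adj G H).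
Proof. by move=> [u|u] [v|v] //=; rewrite adj_sym. Qed.

Lemma union_adj_irr (G H : sgraph) : irreflexive (@union_adj G H).
Proof. by move=> [u|u] /=; rewrite adj_irr. Qed.

Lemma union_gt0 (G H : sgraph) : 0 < #|{: G + H}|.
Proof. by rewrite card_sum addn_gt0 vertex_gt0. Qed.

Definition disjoint_union (G H : sgraph) : sgraph :=
  SGraph (@union_adj_sym G H) (@union_adj_irr G H) (union_gt0 G H).

(* Main.v *)
Require Import Defs.
From mathcomp Require Import all_boot all_order all_algebra.

Set Implicit Arguments.
Unset Strict Implicit.
Unset Printing Implicit Defensive.

Import GRing.Theory.
Local Open Scope ring_scope.

(** Grouping assignments by their domain is only bookkeeping: [FC] is the sum,
    over all forcing assignments [f], of
    ['X ^+ #|pdom f| * (1 - k%:R * 'X) ^+ (#|G| - #|pdom f|)] ([FC_sum]).  Every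
    part of the proposition is read off from this sum.

    - A forcing assignment exists only if a colouring does, so the sum is empty
      below the chromatic number.
    - At 0 only the empty assignment has nonzero weight.  With at least two
      colours it allows no step, because no vertex sees any colour, and it is
      not a colouring because the graph has a vertex; with one colour and
      an edge there is no colouring at all ([forces_pdom_gt0]).
    - At [k^-1] only the total assignments have nonzero weight, and these allow
      no step either, so that they force a colouring exactly when they are one
      ([forces_total]).
    - At [k.+1^-1] the quantities [x] and [1 - k x] coincide, so all forcing
      assignments have the same weight [k.+1%:R ^- #|G|].
    - A step at a vertex looks at and changes only the component of that vertex.
      Hence an assignment of a disjoint union forces a colouring if and only if
      both of its restrictions do ([forces_disjoint_union]); as the weight is a
      product over the vertices ([FC_sum_prod]), the sum factors. *)

(** * The polynomial as a sum over forcing assignments *)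

Lemma FC_sum (R : nzRingType) (G : sgraph) (k : nat) :
  FC R G k = \sum_(f : passign G k | forces_coloring f)
               'X ^+ #|pdom f| * (1 - k%:R * 'X) ^+ (#|G| - #|pdom f|).
Proof.
rewrite (partition_big (@pdom G k) xpredT) //=; apply: eq_bigr => C _.
rewrite (eq_bigr (fun=> 'X ^+ #|C| * (1 - k%:R * 'X) ^+ (#|G| - #|C|))).
  rewrite sumr_const -mulrA mulr_natl; congr (_ *+ _).
  by rewrite /fcol cardsE; apply: eq_card => f; rewrite unfold_in /= [RHS]unfold_in andbC.
by move=> f /andP[_ /eqP ->].
Qed.

Lemma horner_FC (R : comNzRingType) (G : sgraph) (k : nat) (x : R) :
  (FC R G k).[x] = \sum_(f : passign G k | forces_coloring f)
                     x ^+ #|pdom f| * (1 - k%:R * x) ^+ (#|G| - #|pdom f|).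
Proof.
rewrite FC_sum horner_sum; apply: eq_bigr => f _.
by rewrite hornerM !horner_exp hornerX !hornerE -polyC_natr hornerC.
Qed.

Lemma FC_sum_prod (R : comNzRingType) (G : sgraph) (k : nat) :
  FC R G k = \sum_(f : passign G k | forces_coloring f)
               \prod_v (if f v is Some _ then 'X else 1 - k%:R * 'X).
Proof.
rewrite FC_sum; apply: eq_bigr => f _.
rewrite (bigID (mem (pdom f))) /=; congr (_ * _).
  rewrite -prodr_const; apply: eq_bigr => v.
  by rewrite inE; case: (f v).
rewrite -[pdom f]setCK -cardsCs setCK -prodr_const.
by apply: eq_big => v; rewrite !inE //; case: (f v).
Qed.

(** * Which assignments force a colouring *)

Lemma forces_colorable (G : sgraph) (k : nat) (f : passign G k) :
  forces_coloring f -> colorable G k.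
Proof. by case/existsP=> g /andP[_ g_col]; apply/existsP; exists g. Qed.

Lemma chi_min (G : sgraph) (k : nat) : colorable G k -> (chi G <= k)%N.
Proof. by rewrite /chi; case: ex_minnP => m _ min_m /min_m. Qed.

Lemma forces_stuck (G : sgraph) (k : nat) (f : passign G k) :
  (forall v, ~~ imm_forced f v) -> forces_coloring f = coloring f.
Proof.
move=> stuck; apply/existsP/idP => [[g /andP[/connectP[p]]] | f_col].
  case: p => [_ -> //| h p /= /andP[/existsP[v /andP[fv _]] _]].
  by move: (stuck v); rewrite fv.
by exists f; rewrite connect0.
Qed.

Lemma forces_total (G : sgraph) (k : nat) (f : passign G k) :
  forces_coloring f && (pdom f == setT) = coloring f.
Proof.
rewrite andbC; have [f_tot /=|/negPf f_ntot] := eqVneq (pdom f) setT.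
  by apply: forces_stuck => v; rewrite /imm_forced f_tot inE.
by rewrite /coloring f_ntot.
Qed.

Lemma edge_not_colorable1 (G : sgraph) (u v : G) :
  adj u v -> ~~ colorable G 1.
Proof.
move=> uv; apply/negP => /existsP[f /andP[/eqP f_tot]].
move=> /forallP/(_ u)/forallP/(_ v); rewrite uv /=.
have: u \in pdom f by rewrite f_tot inE.
have: v \in pdom f by rewrite f_tot inE.
by rewrite !inE; case: (f u) (f v) => [a|] [b|] //; rewrite (ord1 a) (ord1 b) eqxx.
Qed.

Lemma forces_pdom_gt0 (G : sgraph) (k : nat) (f : passign G k) :
    (0 < k)%N -> (exists u v : G, adj u v) \/ (2 <= k)%N ->
  forces_coloring f -> (0 < #|pdom f|)%N.
Proof.
move=> k_gt0 edge_or_k f_forces; rewrite card_gt0; apply/eqP => f_empty.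
have k_gt1 : (1 < k)%N.
  case: edge_or_k => // -[u [v uv]].
  rewrite ltn_neqAle k_gt0 andbT; apply: contraL (forces_colorable f_forces).
  by move=> /eqP <-; apply: edge_not_colorable1 uv.
have no_colors v : nbh_colors f v = set0.
  apply/setP=> c; rewrite !inE f_empty setI0.
  by apply/existsP => -[w]; rewrite inE.
move: f_forces; rewrite forces_stuck => [/andP[/eqP f_tot _]|v].
  have /card_gt0P[x _] := vertex_gt0 G.
  by have := in_setT x; rewrite -f_tot f_empty inE.
by rewrite /imm_forced no_colors cards0 ltn_eqF ?andbF // -subn1 subn_gt0.
Qed.

(** * Restriction to a union of components *)

(** An isomorphism of [G] onto a union of connected components of [K].  Both
    injections into a disjoint union have this form, which lets one argument
    serve for the two sides. *)
Definition component_embedding (G K : sgraph) (e : G -> K) : Prop :=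
  [/\ injective e, forall u v, adj (e u) (e v) = adj u v
    & forall u w, adj (e u) w -> w \in codom e].

Definition restr (G K : sgraph) (k : nat) (e : G -> K) (f : passign K k) :
  passign G k := [ffun u => f (e u)].

Section Restriction.

Variables (G K : sgraph) (k : nat) (e : G -> K).
Hypothesis e_comp : component_embedding e.
Implicit Type f : passign K k.

Lemma nbh_colors_restr f u : nbh_colors (restr e f) u = nbh_colors f (e u).
Proof.
case: e_comp => _ e_adj e_nbh.
apply/setP=> c; rewrite !inE; apply/existsP/existsP => -[w].
  rewrite !inE !ffunE => /andP[/andP[uw fw] fwc].
  by exists (e w); rewrite !inE e_adj uw fw.
rewrite !inE => /andP[/andP[uw fw] fwc].
have /codomP[w' def_w] := e_nbh _ _ uw.
by exists w'; rewrite !inE !ffunE -e_adj -def_w uw fw.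
Qed.

Lemma imm_forced_restr f u : imm_forced (restr e f) u = imm_forced f (e u).
Proof. by rewrite /imm_forced nbh_colors_restr !inE ffunE. Qed.

Lemma restr_force_ext f u :
  restr e (force_ext f (e u)) = force_ext (restr e f) u.
Proof.
case: e_comp => e_inj _ _; apply/ffunP=> v.
by rewrite !ffunE (inj_eq e_inj) nbh_colors_restr.
Qed.

Lemma restr_force_ext_notin f w :
  w \notin codom e -> restr e (force_ext f w) = restr e f.
Proof.
move=> ew; apply/ffunP=> v; rewrite !ffunE; case: eqP => // evw.
by case/codomP: ew; exists v.
Qed.

(** A step of [K] restricts to a step of [G] or, when taken outside the image
    of [e], to no change at all. *)
Lemma connect_restr f g :
  connect (@force_step K k) f g ->
  connect (@force_step G k) (restr e f) (restr e g).
Proof.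
case/connectP=> p + ->; elim: p f => [|h p IHp] f; first by rewrite connect0.
case/andP=> /existsP[w /andP[fw /eqP def_h]] /IHp; apply: connect_trans.
rewrite def_h; have [/codomP[u def_w]|ew] := boolP (w \in codom e).
  rewrite def_w restr_force_ext; apply: connect1; apply/existsP; exists u.
  by rewrite imm_forced_restr -def_w fw eqxx.
by rewrite restr_force_ext_notin // connect0.
Qed.

(** A forcing sequence in the image of [e] can be carried out in [K] without
    touching the other components; this is what allows forcing sequences in the
    two parts of a disjoint union to be concatenated. *)
Lemma connect_lift f g :
  connect (@force_step G k) (restr e f) g ->
  exists h, [/\ connect (@force_step K k) f h, restr e h = g
              & {in [predC codom e], h =1 f}].
Proof.
case/connectP=> p; elim: p f => [|g1 p IHp] f /=.
  by move=> _ ->; exists f; rewrite connect0.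
case/andP=> /existsP[u /andP[fu /eqP def_g1]] g1p def_g.
move: g1p def_g; rewrite def_g1 -restr_force_ext => g1p def_g.
have [h [fh def_h h_out]] := IHp _ g1p def_g; exists h; split=> //.
  apply: connect_trans fh; apply: connect1; apply/existsP; exists (e u).
  by rewrite -imm_forced_restr fu eqxx.
move=> w ew; rewrite h_out // ffunE; case: eqP => // def_w.
by move: ew; rewrite def_w inE /= codom_f.
Qed.

End Restriction.

(** * Disjoint unions *)

Section DisjointUnion.

Variables (G H : sgraph) (k : nat).
Let K := disjoint_union G H.
Let eG : G -> K := inl.
Let eH : H -> K := inr.

Lemma inl_component : component_embedding eG.
Proof.
by split=> // [u v [] // | u [v|v] // _]; apply: (codom_f eG).
Qed.

Lemma inr_component : component_embedding eH.
Proof.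
by split=> // [u v [] // | u [v|v] // _]; apply: (codom_f eH).
Qed.

Lemma coloring_disjoint_union (f : passign K k) :
  coloring f = coloring (restr eG f) && coloring (restr eH f).
Proof.
apply/andP/andP => [[/eqP f_tot /forallP f_prop] | []].
  have f_dom x : f x != None by have := in_setT x; rewrite -f_tot inE.
  have f_adj x y : adj x y -> f x != f y by move/(_ x)/forallP/(_ y)/implyP: f_prop.
  split; apply/andP; split; try by apply/eqP/setP => v; rewrite !inE ffunE f_dom.
    by do 2![apply/forallP=> ?]; apply/implyP=> uv; rewrite !ffunE; apply: f_adj.
  by do 2![apply/forallP=> ?]; apply/implyP=> uv; rewrite !ffunE; apply: f_adj.
move=> /andP[/eqP totG /forallP propG] /andP[/eqP totH /forallP propH].
split.
  apply/eqP/setP=> -[v|v].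
    by have := in_setT v; rewrite -totG !inE ffunE.
  by have := in_setT v; rewrite -totH !inE ffunE.
apply/forallP=> -[u|u]; apply/forallP=> -[v|v] //=.
  by move/(_ u)/forallP/(_ v): propG; rewrite !ffunE.
by move/(_ u)/forallP/(_ v): propH; rewrite !ffunE.
Qed.

Lemma forces_disjoint_union (f : passign K k) :
  forces_coloring f = forces_coloring (restr eG f) && forces_coloring (restr eH f).
Proof.
apply/existsP/andP => [[h /andP[fh]] | [/existsP[gG /andP[fG colG]]]].
  rewrite coloring_disjoint_union => /andP[colG colH].
  split; apply/existsP.
    by exists (restr eG h); rewrite colG (connect_restr inl_component fh).
  by exists (restr eH h); rewrite colH (connect_restr inr_component fh).
move=> /existsP[gH /andP[fH colH]].
have [h1 [fh1 def_gG h1_out]] := connect_lift inl_component fG.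
have h1H : restr eH h1 = restr eH f.
  apply/ffunP=> v; rewrite !ffunE h1_out // inE /=.
  by apply/codomP => -[].
rewrite -h1H in fH.
have [h2 [h12 def_gH h2_out]] := connect_lift inr_component fH.
have h2G : restr eG h2 = restr eG h1.
  apply/ffunP=> v; rewrite !ffunE h2_out // inE /=.
  by apply/codomP => -[].
exists h2; rewrite (connect_trans fh1 h12) coloring_disjoint_union.
by rewrite h2G def_gG def_gH colG.
Qed.

Definition join_passign (fg : passign G k * passign H k) : passign K k :=
  [ffun x : K => match x with inl u => fg.1 u | inr v => fg.2 v end].

Lemma restr_joinl fg : restr eG (join_passign fg) = fg.1.
Proof. by apply/ffunP=> u; rewrite !ffunE. Qed.

Lemma restr_joinr fg : restr eH (join_passign fg) = fg.2.
Proof. by apply/ffunP=> v; rewrite !ffunE. Qed.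

Lemma join_passign_bij : bijective join_passign.
Proof.
exists (fun f => (restr eG f, restr eH f)) => [[f g]|f].
  by rewrite restr_joinl restr_joinr.
by apply/ffunP=> -[u|v]; rewrite !ffunE.
Qed.

Lemma FC_disjoint_union (R : comNzRingType) :
  FC R K k = FC R G k * FC R H k.
Proof.
rewrite !FC_sum_prod big_distrlr /= pair_big /=.
rewrite (reindex join_passign) /=; last exact/onW_bij/join_passign_bij.
apply: eq_big => [fg | fg _].
  by rewrite forces_disjoint_union restr_joinl restr_joinr.
rewrite big_sumType /=.
by congr (_ * _); apply: eq_bigr => v _; rewrite ffunE.
Qed.

End DisjointUnion.

(** * Special values *)

Lemma FC_lt_chi (R : nzRingType) (G : sgraph) (k : nat) :
  (k < chi G)%N -> FC R G k = 0.
Proof.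
move=> k_lt; rewrite FC_sum big1 // => f /forces_colorable/chi_min.
by rewrite leqNgt k_lt.
Qed.

Lemma FC_at0 (R : comNzRingType) (G : sgraph) (k : nat) :
    (0 < k)%N -> (exists u v : G, adj u v) \/ (2 <= k)%N ->
  (FC R G k).[0] = 0.
Proof.
move=> k_gt0 edge_or_k; rewrite horner_FC big1 // => f f_forces.
by rewrite expr0n -leqn0 leqNgt (forces_pdom_gt0 k_gt0 edge_or_k f_forces) mul0r.
Qed.

Lemma FC_at_inv (R : numFieldType) (G : sgraph) (k : nat) : (0 < k)%N ->
  k%:R ^+ #|G| * (FC R G k).[k%:R^-1] = (num_colorings G k)%:R.
Proof.
move=> k_gt0; have k_neq0 : k%:R != 0 :> R by rewrite Num.Theory.pnatr_eq0 -lt0n.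
rewrite horner_FC divff // subrr (bigID (fun f => pdom f == setT)) /=.
rewrite [X in _ + X]big1 ?addr0 => [|f /andP[_ f_ntot]].
  rewrite (eq_bigr (fun=> k%:R ^- #|G|)) => [|f /andP[_ /eqP ->]].
    rewrite sumr_const mulrnAr divff ?expf_neq0 //; congr _%:R.
    rewrite /num_colorings cardsE; apply: eq_card => f.
    by rewrite unfold_in forces_total.
  by rewrite cardsT subnn expr0 mulr1 exprVn.
rewrite expr0n subn_eq0 -cardsT; have := f_ntot.
by rewrite eqEcard subsetT /= => /negPf ->; rewrite mulr0.
Qed.

Lemma FC_at_invS (R : numFieldType) (G : sgraph) (k : nat) :
  k.+1%:R ^+ #|G| * (FC R G k).[k.+1%:R^-1] = (num_forcing G k)%:R.
Proof.
have k_neq0 : k.+1%:R != 0 :> R by rewrite Num.Theory.pnatr_eq0.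
have same_weight : 1 - k%:R * k.+1%:R^-1 = k.+1%:R^-1 :> R.
  by rewrite -[X in X - _](divff k_neq0) -mulrBl -natrB // subSnn mul1r.
rewrite horner_FC same_weight (eq_bigr (fun=> k.+1%:R ^- #|G|)) => [|f _].
  rewrite sumr_const mulrnAr divff ?expf_neq0 //.
  by rewrite /num_forcing cardsE.
by rewrite -exprD subnKC ?max_card // exprVn.
Qed.

Theorem proposition4 (R : numFieldType) (G : sgraph) (lambda : nat)
    (lambda_gt0 : (0 < lambda)%N) :
  [/\ (* a *) (lambda < chi G)%N -> FC R G lambda = 0,
      (* b *) (exists u v : G, adj u v) \/ (2 <= lambda)%N ->
              (FC R G lambda).[0] = 0,
      (* c *) lambda%:R ^+ #|G| * (FC R G lambda).[lambda%:R^-1]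
              = (num_colorings G lambda)%:R,
      (* d *) lambda.+1%:R ^+ #|G| * (FC R G lambda).[lambda.+1%:R^-1]
              = (num_forcing G lambda)%:R
    & (* e *) forall H : sgraph,
              FC R (disjoint_union G H) lambda
              = FC R G lambda * FC R H lambda].
Proof.
split; [exact: FC_lt_chi | exact: FC_at0 | exact: FC_at_inv
       | exact: FC_at_invS | move=> H; exact: FC_disjoint_union].
Qed.
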